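(* Let $m,d,\tau,d_{\mathrm t}>0$ and $d_{\mathrm b}\ge 0$. Consider the power network under the proportionality assumption with representative generator $$\hat g_{\mathrm o}(s)=\frac{\tau s+1}{m\tau s^2+(m+d\tau)s+d+d_{\mathrm t}}$$ and frequency shaping control $\hat c_{\mathrm o}(s)=\hat c_{\mathrm{fs}}(s)=\frac{d_{\mathrm t}}{\tau s+1}-(d_{\mathrm b}+d_{\mathrm t})$. Let $0=\lambda_1<\lambda_2\le\dots\le\lambda_n$ be the eigenvalues of the scaled Laplacian $\boldsymbol L$, and let $$\hat z_{k,\mathrm{fs}}(s)=\frac{\hat g_{\mathrm o}(s)}{1+\hat g_{\mathrm o}(s)\left(\lambda_k/s-\hat c_{\mathrm{fs}}(s)\right)},\qquad k\in\{2,\dots,n\}.$$ Then the minimum damping ratio $\cos\overline\psi$ and the minimum decay rate $\underline\alpha$ among (all poles of) all $\hat z_{k,\mathrm{fs}}(s)$, $k\in\{2,\dots,n\}$, are: (minimum damping ratio) $$\cos\overline\psi=\begin{cases}\dfrac{d+d_{\mathrm b}+d_{\mathrm t}}{2\sqrt{\lambda_n m}} & \text{if } 0\le d_{\mathrm b}<2\sqrt{\lambda_n m}-d-d_{\mathrm t},\\[2mm] 1 & \text{otherwise;}\end{cases}$$ (minimum decay rate) $$\underline\alpha=\begin{cases}\dfrac{d+d_{\mathrm b}+d_{\mathrm t}}{2m}=|\sigma_{\mathrm a}| & \text{if } 0\le d_{\mathrm b}\le 2\sqrt{\lambda_2 m}-d-d_{\mathrm t},\\[2mm] \dfrac{d+d_{\mathrm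 b}+d_{\mathrm t}-\sqrt{(d+d_{\mathrm b}+d_{\mathrm t})^2-4\lambda_2 m}}{2m}<|\sigma_{\mathrm a}| & \text{otherwise,}\end{cases}$$ where $\sigma_{\mathrm a}=-\dfrac{d+d_{\mathrm b}+d_{\mathrm t}}{2m}$.
   Context: Power network model: $n\ge2$ buses, connected network; $\boldsymbol L_{\mathrm B}\in\mathbb R^{n\times n}$ is its undirected weighted Laplacian (symmetric, positive semidefinite, kernel spanned by the all-ones vector). Proportionality assumption: there are $r_i>0$ such that bus $i$ has generator transfer function $\hat g_i=\hat g_{\mathrm o}/r_i$ and inverter transfer function $\hat c_i=r_i\hat c_{\mathrm o}$. With $\boldsymbol R=\mathrm{diag}(r_1,\dots,r_n)$, the scaled Laplacian is $\boldsymbol L=\boldsymbol R^{-1/2}\boldsymbol L_{\mathrm B}\boldsymbol R^{-1/2}$. Poles of a rational function are understood after cancellation of common factors. For a pole $s$ with $\mathrm{Re}(s)<0$: its decay rate is $-\mathrm{Re}(s)$; its damping ratio is $\cos\psi=-\mathrm{Re}(s)/|s|$, where $\psi\in[0,\pi/2)$ is the angle between the segment joining $s$ to the origin and the negative real axis. *)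

(* Defs.v *)
From mathcomp Require Import all_boot all_order all_algebra.
From mathcomp Require Import fraction complex.
From mathcomp Require Import boolp classical_sets reals.

Set Implicit Arguments.
Unset Strict Implicit.
Unset Printing Implicit Defensive.

Import Order.TTheory GRing.Theory Num.Theory.
Local Open Scope ring_scope.
Local Open Scope classical_set_scope.

(* Rational transfer functions with real coefficients; common factors are
   identified by construction of the fraction field. *)
Notation tf R := {fraction {poly R}}.

Definition ptf (R : realType) (p : {poly R}) : tf R := tofrac p.
Definition ctf (R : realType) (c : R) : tf R := ptf c%:P.
Definition stf (R : realType) : tf R := ptf 'X.

(* Real coefficients, complex poles: [s] is a root of the denominator in
   lowest terms (coprimality over R and over R[i] agree). *)
Definition is_pole (R : realType) (f : tf R) (s : R[i]) : Prop :=
  exists p q : {poly R},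
    [/\ q != 0, coprimep p q, f = ptf p / ptf q
      & root (map_poly (real_complex R) q) s].

Definition decay_rate (R : realType) (s : R[i]) : R := - complex.Re s.

Definition damping_ratio (R : realType) (s : R[i]) : R :=
  - complex.Re s / complex.Re `|s|.

Definition is_minimum (R : realType) (A : set R) (x : R) : Prop :=
  A x /\ lbound A x.

(* [weight i j] is the weight of line {i, j}, 0 when there is no such line;
   the diagonal is irrelevant both to connectedness and to the Laplacian. *)
Record power_network (R : realType) (n : nat) := PowerNetwork {
  weight : 'M[R]_n;
  weight_sym : forall i j, weight i j = weight j i;
  weight_ge0 : forall i j, 0 <= weight i j;
  network_connected : forall i j, connect [rel k l | 0 < weight k l] i j;
  gen_tf : 'I_n -> tf R;
  inverter_tf : 'I_n -> tf R
}.

Definition laplacian (R : realType) (n : nat) (N : power_network R n) :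
    'M[R]_n :=
  diag_mx (\row_i \sum_j weight N i j) - weight N.

Definition proportional (R : realType) (n : nat) (N : power_network R n)
    (r : 'I_n -> R) (go co : tf R) : Prop :=
  forall i, [/\ 0 < r i, gen_tf N i = go / ctf (r i) & inverter_tf N i = ctf (r i) * co].

Definition scaled_laplacian (R : realType) (n : nat) (N : power_network R n)
    (r : 'I_n -> R) : 'M[R]_n :=
  let Rmhalf := diag_mx (\row_i (Num.sqrt (r i))^-1) in
  Rmhalf *m laplacian N *m Rmhalf.

(* The eigenvalues of [A], with multiplicity, in nondecreasing order. *)
Definition sorted_eigenvalues (R : realType) (n : nat) (A : 'M[R]_n)
    (lam : n.-tuple R) : Prop :=
  sorted <=%R lam /\ char_poly A = \prod_(x <- lam) ('X - x%:P).

Definition g_o (R : realType) (m d tau dt : R) : tf R :=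
  (ctf tau * stf R + 1) /
  (ctf (m * tau) * stf R ^+ 2 + ctf (m + d * tau) * stf R + ctf (d + dt)).

Definition c_fs (R : realType) (tau db dt : R) : tf R :=
  ctf dt / (ctf tau * stf R + 1) - ctf (db + dt).

Definition z_mode (R : realType) (go co : tf R) (lambda : R) : tf R :=
  go / (1 + go * (ctf lambda / stf R - co)).

(* Indices are 0-based: [lam`_k] is $\lambda_{k+1}$, so $\lambda_1$ is left out. *)
Definition mode_poles (R : realType) (n : nat) (go co : tf R)
    (lam : n.-tuple R) : set R[i] :=
  [set s | exists2 k : nat, (1 <= k < n)%N & is_pole (z_mode go co lam`_k) s].

(* Main.v *)
(* Multiplying out, z = s / (m s^2 + D s + lambda) with D = d + db + dt, a
   fraction in lowest terms as soon as lambda > 0; its poles are the roots of a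
   quadratic, whose damping ratio and slowest decay rate are respectively
   nonincreasing and nondecreasing in lambda, so that the extremal modes are
   lambda_n and lambda_2. The scaled Laplacian is positive semidefinite, and
   connectedness makes its kernel the line spanned by (sqrt r_i)_i; being
   symmetric, it then has 0 as a simple eigenvalue, i.e. lambda_1 = 0 <
   lambda_2. *)

Require Import Defs.
From mathcomp Require Import all_boot all_order all_algebra.
From mathcomp Require Import fraction complex.
From mathcomp Require Import boolp classical_sets reals.
From mathcomp Require Import zify ring lra.

Set Implicit Arguments.
Unset Strict Implicit.
Unset Printing Implicit Defensive.

Import Order.TTheory GRing.Theory Num.Theory.
Local Open Scope ring_scope.
Local Open Scope classical_set_scope.

(** * Simplicity of the root [0] of a characteristic polynomial *)

(* Replacing row [i0] of [char_poly_mx A] by its combination with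
   coefficients [u] extracts a factor ['X]; what remains is nonsingular
   at [0]. *)
Lemma char_poly_simple_root0 (F : fieldType) (n : nat) (A : 'M[F]_n)
    (u : 'rV[F]_n) :
  A^T = A -> u *m A = 0 -> u *m u^T != 0 ->
  (forall v : 'rV_n, v *m A = 0 -> exists c, v = c *: u) ->
  ~~ ('X^2 %| char_poly A).
Proof.
move=> symA uA0 uu0 kerA.
have [i0 ui0] : exists i0, u 0 i0 != 0.
  apply/existsP; apply: contraNT uu0 => /existsPn u0.
  apply/eqP/matrixP => i j; rewrite !mxE big1 // => k _.
  by rewrite (ord1 i); move: (u0 k); rewrite negbK => /eqP ->; rewrite mul0r.
pose M := char_poly_mx A.
pose T : 'M[{poly F}]_n :=
  \matrix_(i, j) (if i == i0 then u 0 j else (i == j)%:R)%:P.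
pose M' : 'M[{poly F}]_n :=
  \matrix_(i, j) (if i == i0 then (u 0 j)%:P else M i j).
have TM_row i j : (T *m M) i j = if i == i0 then 'X * M' i j else M' i j.
  rewrite !mxE; case: (eqVneq i i0) => [->|ne].
    have uAj : \sum_k u 0 k * A k j = 0.
      by move/matrixP: uA0 => /(_ 0 j); rewrite !mxE.
    transitivity (\sum_k (u 0 k)%:P * ('X *+ (k == j))
                  - \sum_k (u 0 k * A k j)%:P).
      rewrite -sumrB; apply: eq_bigr => k _.
      by rewrite !mxE eqxx polyCM mulrBr.
    rewrite -[X in _ - X]rmorph_sum uAj subr0 (bigD1 j) //= eqxx mulr1n.
    rewrite big1 ?addr0; first by rewrite mulrC.
    by move=> k /negPf ->; rewrite mulr0n mulr0.
  rewrite (bigD1 i) //= !mxE (negPf ne) eqxx mul1r big1 ?addr0 //.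
  move=> k; rewrite eq_sym => /negPf nk.
  by rewrite !mxE (negPf ne) nk mul0r.
have row'_TM : row' i0 M' = row' i0 (T *m M).
  apply/matrixP => i j; rewrite mxE [RHS]mxE TM_row.
  by rewrite eq_sym (negPf (neq_lift _ _)).
have detTM : \det T * char_poly A = 'X * \det M'.
  rewrite -det_mulmx.
  (* Multilinearity with second coefficient [0] is plain scaling of row [i0]. *)
  rewrite (@determinant_multilinear _ _ (T *m M) M' M' i0 'X 0).
  - by rewrite mul0r addr0.
  - by apply/rowP => j; rewrite mxE TM_row eqxx !mxE eqxx mul0r addr0.
  - exact: row'_TM.
  - exact: row'_TM.
apply/negP => /dvdpP[q chA].
have detM' : \det M' = \det T * q * 'X.
  apply: (mulfI (negbT (polyX_eq0 F))).
  by rewrite -detTM chA expr2; ring.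
(* Divisibility by ['X^2] makes [M0] singular. Its row [i0] is [u] and its other rows come from
   [- A], so a null vector [v] is orthogonal to [u] and [v *m A] vanishes off [i0]. *)
pose M0 := map_mx (horner_eval 0) M'.
have : \det M0^T == 0.
  by rewrite det_tr det_map_mx /= detM' /horner_eval hornerMX mulr0.
case/det0P => v v0 vM0.
have vM0E i : \sum_k v 0 k * M0 i k = 0.
  move/matrixP: vM0 => /(_ 0 i); rewrite !mxE => vM0i; rewrite -[RHS]vM0i.
  by apply: eq_bigr => k _; rewrite !mxE.
have AE i j : A i j = A j i by rewrite -[in LHS]symA mxE.
have vA i : i != i0 -> (v *m A) 0 i = 0.
  move=> ne; apply/eqP; rewrite -oppr_eq0 -(vM0E i) mxE -sumrN; apply/eqP.
  apply: eq_bigr => k _; rewrite !mxE (negPf ne) /horner_eval.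
  by rewrite !hornerE hornerMn hornerX mul0rn sub0r mulrN AE.
have vu : v *m u^T = 0.
  apply/matrixP => i j; rewrite !ord1 !mxE -[RHS](vM0E i0).
  by apply: eq_bigr => k _; rewrite !mxE eqxx /horner_eval hornerC.
have vA0 : v *m A = 0.
  apply/rowP => i; rewrite [RHS]mxE; case: (eqVneq i i0) => [->|/vA //].
  (* Pairing [v *m A] with [u] gives [0] by symmetry and leaves only the [i0] term, where [u] is
     nonzero. *)
  have : (v *m A *m u^T) 0 0 = 0.
    by rewrite -symA -mulmxA -trmx_mul uA0 trmx0 mulmx0 mxE.
  rewrite mxE (bigD1 i0) //= big1 ?addr0 => [|k /vA ->]; last by rewrite mul0r.
  rewrite [in X in _ * X]mxE => /eqP.
  by rewrite mulf_eq0 (negPf ui0) orbF => /eqP.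
have [c vE] := kerA _ vA0.
move: vu; rewrite vE -scalemxAl => /eqP.
rewrite scaler_eq0 (negPf uu0) orbF => /eqP c0.
by rewrite vE c0 scale0r eqxx in v0.
Qed.

(** * Spectrum of the scaled Laplacian of a connected network *)

Section ScaledLaplacian.
Variables (R : realType) (n : nat) (N : power_network R n).

Lemma mulmx_laplacian (w : 'rV[R]_n) j :
  (w *m laplacian N) 0 j = \sum_k weight N j k * (w 0 j - w 0 k).
Proof.
rewrite mulmxBr !mxE.
rewrite (bigD1 j) //= big1 ?addr0 => [|k /negPf nk]; last first.
  by rewrite !mxE nk mulr0.
rewrite !mxE eqxx mulr1n mulr_sumr -sumrB; apply: eq_bigr => k _.
by rewrite (weight_sym N k j); ring.
Qed.

(** Adding the double sum to its copy with exchanged indices completes the squares; the factor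
    [2^-1] undoes this doubling. *)
Lemma laplacian_quadratic (w : 'rV[R]_n) :
  (w *m laplacian N *m w^T) 0 0 =
  2^-1 * \sum_i \sum_j weight N i j * (w 0 i - w 0 j) ^+ 2.
Proof.
set S := _ 0 0.
have SE : S = \sum_i \sum_j weight N i j * (w 0 i - w 0 j) * w 0 i.
  rewrite /S mxE; apply: eq_bigr => i _.
  by rewrite mulmx_laplacian mxE mulr_suml.
have SE' : S = \sum_i \sum_j weight N i j * (w 0 j - w 0 i) * w 0 j.
  rewrite SE exchange_big; apply: eq_bigr => i _; apply: eq_bigr => j _.
  by rewrite (weight_sym N j i).
have -> : \sum_i \sum_j weight N i j * (w 0 i - w 0 j) ^+ 2 = S + S.
  rewrite {1}SE SE' -big_split; apply: eq_bigr => i _.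
  by rewrite -big_split; apply: eq_bigr => j _ /=; ring.
by field.
Qed.

Lemma laplacian_quadratic_ge0 (w : 'rV[R]_n) :
  0 <= (w *m laplacian N *m w^T) 0 0.
Proof.
rewrite laplacian_quadratic mulr_ge0 ?invr_ge0 //.
by do 2!apply: sumr_ge0 => ? _; rewrite mulr_ge0 ?weight_ge0 ?sqr_ge0.
Qed.

(** A zero quadratic form kills each of its nonnegative terms, so [w] agrees across every line of
    positive weight, and connectedness spreads this along paths. *)
Lemma laplacian_kernel (w : 'rV[R]_n) :
  w *m laplacian N = 0 -> forall i j, w 0 i = w 0 j.
Proof.
move=> wL0.
have ge0 i j : 0 <= weight N i j * (w 0 i - w 0 j) ^+ 2.
  by rewrite mulr_ge0 ?weight_ge0 ?sqr_ge0.
have := laplacian_quadratic w; rewrite wL0 mul0mx mxE => /esym/eqP.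
rewrite mulf_eq0 invr_eq0 pnatr_eq0 /= => /eqP sum0.
have edge i j : 0 < weight N i j -> w 0 i = w 0 j.
  move=> wij.
  have sum0i : \sum_k weight N i k * (w 0 i - w 0 k) ^+ 2 = 0.
    by apply: (psumr_eq0P _ sum0) => // k _; apply: sumr_ge0.
  have /eqP : weight N i j * (w 0 i - w 0 j) ^+ 2 = 0.
    exact: (psumr_eq0P _ sum0i).
  by rewrite mulf_eq0 gt_eqF //= sqrf_eq0 subr_eq0 => /eqP.
move=> i j; case/connectP: (network_connected N i j) => p + ->.
elim: p i => //= k p IHp i /andP[/edge ->]; exact: IHp.
Qed.

Lemma trmx_laplacian : (laplacian N)^T = laplacian N.
Proof.
rewrite linearB /= tr_diag_mx; congr (_ - _).
by apply/matrixP => i j; rewrite mxE weight_sym.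
Qed.

Variable r : 'I_n -> R.
Hypothesis r_gt0 : forall i, 0 < r i.

Let S := diag_mx (\row_i (Num.sqrt (r i))^-1).
Let A := scaled_laplacian N r.
Let u : 'rV[R]_n := \row_i Num.sqrt (r i).

Let mul_rowS (v : 'rV[R]_n) i : (v *m S) 0 i = v 0 i / Num.sqrt (r i).
Proof. by rewrite mul_mx_diag !mxE. Qed.

Let unitS : S \in unitmx.
Proof.
rewrite unitmxE det_diag unitfE; apply/prodf_neq0 => i _.
by rewrite mxE invr_eq0 gt_eqF // sqrtr_gt0.
Qed.

Lemma trmx_scaled_laplacian : A^T = A.
Proof.
by rewrite /A /scaled_laplacian !trmx_mul tr_diag_mx trmx_laplacian mulmxA.
Qed.

Lemma scaled_laplacian_quadratic_ge0 (v : 'rV[R]_n) : 0 <= (v *m A *m v^T) 0 0.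
Proof.
have -> : v *m A *m v^T = (v *m S) *m laplacian N *m (v *m S)^T.
  by rewrite trmx_mul tr_diag_mx !mulmxA.
exact: laplacian_quadratic_ge0.
Qed.

Lemma scaled_laplacian_sqrt : u *m A = 0.
Proof.
rewrite /A /scaled_laplacian -/S !mulmxA.
suff -> : u *m S *m laplacian N = 0 by rewrite mul0mx.
apply/rowP => j; rewrite mulmx_laplacian [RHS]mxE big1 // => k _.
by rewrite !mul_rowS !mxE !divff ?gt_eqF ?sqrtr_gt0 // subrr mulr0.
Qed.

Lemma scaled_laplacian_kernel (v : 'rV[R]_n) :
  v *m A = 0 -> exists c, v = c *: u.
Proof.
rewrite /A /scaled_laplacian -/S !mulmxA => vA0.
have /laplacian_kernel vS : v *m S *m laplacian N = 0.
  by rewrite -[LHS](mulmxK unitS) vA0 mul0mx.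
(* For [n = 0] there is no entry to read the constant from, and any scalar works. *)
case: (pickP 'I_n) => [i0 _|no]; last first.
  by exists 0; apply/rowP => i; move: (no i).
exists ((v *m S) 0 i0); apply/rowP => i.
by rewrite (vS i0 i) mul_rowS !mxE divfK // gt_eqF ?sqrtr_gt0.
Qed.

(** The quadratic form makes all eigenvalues nonnegative, [u] shows that [0] is among them, and a
    second zero would put ['X^2] into the characteristic polynomial. *)
Lemma scaled_laplacian_eigenvalues (lam : n.-tuple R) :
  (1 < n)%N -> sorted_eigenvalues A lam -> lam`_0 = 0 /\ 0 < lam`_1.
Proof.
move=> n_gt1 [srt chA].
have n_gt0 := ltnW n_gt1.
have uu : u *m u^T != 0.
  apply/eqP => /matrixP /(_ 0 0); rewrite !mxE => /eqP.
  rewrite gt_eqF // (bigD1 (Ordinal n_gt0)) //= ltr_pwDl //.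
    by rewrite !mxE mulr_gt0 ?sqrtr_gt0.
  by apply: sumr_ge0 => i _; rewrite !mxE mulr_ge0 ?sqrtr_ge0.
have memE x : (x \in lam) = root (char_poly A) x.
  by rewrite chA root_prod_XsubC.
have lam_ge0 x : x \in lam -> 0 <= x.
  rewrite memE -eigenvalue_root_char => /eigenvalueP[v vA v0].
  have := scaled_laplacian_quadratic_ge0 v; rewrite vA -scalemxAl mxE.
  rewrite pmulr_lge0 // mxE lt_def psumr_eq0 => [|i _]; last first.
    by rewrite mxE -expr2 sqr_ge0.
  rewrite sumr_ge0 => [|i _]; last by rewrite mxE -expr2 sqr_ge0.
  rewrite andbT; apply: contra v0 => /allP v0; apply/eqP/rowP => i.
  have := v0 i (mem_index_enum _).
  by rewrite !mxE mulf_eq0 orbb => /eqP.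
have lam0 : 0 \in lam.
  rewrite memE -eigenvalue_root_char; apply/eigenvalueP; exists u.
    by rewrite scaled_laplacian_sqrt scale0r.
  by apply: contraNneq uu => ->; rewrite mul0mx.
have mono := sorted_leq_nth le_trans le_refl 0 srt.
have lamk_ge0 k : (k < n)%N -> 0 <= lam`_k.
  by move=> kn; apply: lam_ge0; rewrite mem_nth // size_tuple.
have lam00 : lam`_0 = 0.
  apply/le_anti; rewrite lamk_ge0 // andbT.
  have ilt : (index 0%R lam < size lam)%N by rewrite index_mem.
  by rewrite -[leRHS](nth_index 0 lam0) mono // inE size_tuple.
split=> //; rewrite lt_def lamk_ge0 // andbT; apply/eqP => lam10.
have := char_poly_simple_root0 trmx_scaled_laplacian scaled_laplacian_sqrt uu
  scaled_laplacian_kernel.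
move: chA lam00 lam10; have := size_tuple lam.
case: (tval lam) => [|x [|y s]] /=; [lia | lia |].
move=> _ -> -> ->; rewrite !big_cons subr0 mulrA -expr2.
by rewrite dvdp_mulr.
Qed.

End ScaledLaplacian.

(** * Modes in lowest terms and their poles *)

Lemma mode_fieldE (F : fieldType) (X m d t dt db l : F) :
  X != 0 -> t * X + 1 != 0 ->
  m * t * X ^+ 2 + (m + d * t) * X + (d + dt) != 0 ->
  m * X ^+ 2 + (d + db + dt) * X + l != 0 ->
  let g := (t * X + 1) / (m * t * X ^+ 2 + (m + d * t) * X + (d + dt)) in
  let c := dt / (t * X + 1) - (db + dt) in
  g / (1 + g * (l / X - c)) = X / (m * X ^+ 2 + (d + db + dt) * X + l).
Proof.
move=> X0 t0 g0 P0 /=.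
field; rewrite P0 t0 X0 g0 /=.
(* The side condition left by [field] concerns the cleared denominator, which is the product of
   [t * X + 1] and the quadratic. *)
apply: contraNneq (mulf_neq0 t0 P0) => <-.
by apply/eqP; ring.
Qed.

Definition mode_denom (R : realType) (m D l : R) : {poly R} :=
  m%:P * 'X^2 + D%:P * 'X + l%:P.

(** These are the real and imaginary parts of the value at [a +i* b]; factoring out [b] separates
    real roots from conjugate pairs. *)
Lemma root_mode_denom (R : realType) (m D l a b : R) :
  root (map_poly (real_complex R) (mode_denom m D l)) (a +i* b)%C <->
  m * (a ^+ 2 - b ^+ 2) + D * a + l = 0 /\ b * (2 * m * a + D) = 0.
Proof.
rewrite /mode_denom !rmorphD !rmorphM /= !map_polyC map_polyX /=.
rewrite rootE !(hornerD, hornerM, hornerC, hornerX) eq_complex /=.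
split=> [/andP[/eqP re /eqP im]|[re im]].
  by split; [rewrite -[RHS]re|rewrite -[RHS]im]; ring.
by apply/andP; split; apply/eqP; [rewrite -[RHS]re|rewrite -[RHS]im]; ring.
Qed.

(** By Gauss's lemma the denominator of any coprime representation divides [q], so a single
    representation decides all poles. *)
Lemma is_pole_reduced (R : realType) (p q : {poly R}) (s : R[i]) :
  q != 0 -> coprimep p q ->
  is_pole (ptf p / ptf q) s <-> root (map_poly (real_complex R) q) s.
Proof.
move=> q0 copq; split; last by move=> qs; exists p, q.
case=> p' [q' [q'0 copq' + q's]].
rewrite /ptf => /eqP; rewrite eqr_div ?tofrac_eq0 // -!tofracM tofrac_eq.
move=> /eqP pq'.
have /dvdpP[c ->] : q' %| q.
  by rewrite -(@Gauss_dvdpr _ _ p') 1?coprimep_sym // -pq' dvdp_mull.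
by rewrite rmorphM rootM q's orbT.
Qed.

Lemma horner_neq0 (R : nzRingType) (p : {poly R}) (x : R) :
  p.[x] != 0 -> p != 0.
Proof. by apply: contraNneq => ->; rewrite horner0. Qed.

(* The reciprocal of [z_mode] is [m s + D + l / s]: the control cancels the
   turbine term [dt / (tau s + 1)] of the reciprocal of [g_o]. *)
Lemma z_mode_fs (R : realType) (m d tau dt db l : R) :
  0 < d -> 0 < dt -> 0 < l ->
  z_mode (g_o m d tau dt) (c_fs tau db dt) l =
  ptf 'X / ptf (mode_denom m (d + db + dt) l).
Proof.
move=> d_gt0 dt_gt0 l_gt0; rewrite /z_mode /g_o /c_fs.
have ctfM (x y : R) : ctf (x * y) = ctf x * ctf y.
  by rewrite /ctf /ptf polyCM tofracM.
have ctfD (x y : R) : ctf (x + y) = ctf x + ctf y.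
  by rewrite /ctf /ptf polyCD tofracD.
have -> : ptf (mode_denom m (d + db + dt) l) =
    ctf m * stf R ^+ 2 + ctf (d + db + dt) * stf R + ctf l.
  by rewrite /ptf /mode_denom !tofracD !tofracM ?expr2.
have X0 : stf R != 0 by rewrite /stf /ptf tofrac_eq0 polyX_eq0.
(* The three denominators are nonzero since at [0] they take the values [1], [d + dt] and [l]. *)
have t0 : ctf tau * stf R + 1 != 0.
  rewrite /ctf /stf /ptf -tofracM -tofrac1 -tofracD tofrac_eq0.
  by apply: (@horner_neq0 _ _ 0);
    rewrite !(hornerD, hornerM, hornerC, hornerX, mulr0, add0r) oner_eq0.
have g0 : ctf (m * tau) * stf R ^+ 2 + ctf (m + d * tau) * stf R
    + ctf (d + dt) != 0.
  rewrite /ctf /stf /ptf -tofracXn -!tofracM -!tofracD tofrac_eq0.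
  apply: (@horner_neq0 _ _ 0).
  rewrite !(hornerD, hornerM, hornerC, hornerX, expr2, mulr0, add0r).
  by rewrite gt_eqF ?addr_gt0.
have P0 : ctf m * stf R ^+ 2 + ctf (d + db + dt) * stf R + ctf l != 0.
  rewrite /ctf /stf /ptf -tofracXn -!tofracM -!tofracD tofrac_eq0.
  apply: (@horner_neq0 _ _ 0).
  rewrite !(hornerD, hornerM, hornerC, hornerX, expr2, mulr0, add0r).
  by rewrite gt_eqF ?addr_gt0.
move: t0 g0 P0; rewrite !(ctfM, ctfD) => t0 g0 P0.
by have /= -> := @mode_fieldE (tf R) _ (ctf m) (ctf d) (ctf tau) (ctf dt)
  (ctf db) (ctf l) X0 t0 g0 P0.
Qed.

Lemma is_pole_mode (R : realType) (m d tau dt db l a b : R) :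
  0 < d -> 0 < dt -> 0 < l ->
  let D := d + db + dt in
  is_pole (z_mode (g_o m d tau dt) (c_fs tau db dt) l) (a +i* b)%C <->
  m * (a ^+ 2 - b ^+ 2) + D * a + l = 0 /\ b * (2 * m * a + D) = 0.
Proof.
move=> d_gt0 dt_gt0 l_gt0 D.
rewrite z_mode_fs // is_pole_reduced ?root_mode_denom //.
- apply: (@horner_neq0 _ _ 0); rewrite /mode_denom.
  by rewrite !(hornerD, hornerM, hornerC, hornerX, expr2, mulr0, add0r) gt_eqF.
- rewrite coprimep_sym -['X]subr0 -polyC0 coprimep_XsubC rootE /mode_denom.
  rewrite !(hornerD, hornerM, hornerC, hornerX, expr2, mulr0, add0r).
  by rewrite gt_eqF.
Qed.

(** * Roots of the quadratic [m s^2 + D s + l] *)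

Section QuadraticMode.
Variables (R : realType) (m D l : R).
Hypotheses (m_gt0 : 0 < m) (D_gt0 : 0 < D) (l_gt0 : 0 < l).

Lemma lt_2sqrt : (D < 2 * Num.sqrt (l * m)) = (D ^+ 2 < 4 * l * m).
Proof.
have lm_ge0 : 0 <= l * m by rewrite ltW ?mulr_gt0.
rewrite -(ltr_pXn2r (n := 2)) ?nnegrE ?mulr_ge0 ?sqrtr_ge0 ?(ltW D_gt0) //.
by rewrite exprMn sqr_sqrtr // -natrX mulrA.
Qed.

Lemma le_2sqrt : (D <= 2 * Num.sqrt (l * m)) = (D ^+ 2 <= 4 * l * m).
Proof.
have lm_ge0 : 0 <= l * m by rewrite ltW ?mulr_gt0.
rewrite -(ler_pXn2r (n := 2)) ?nnegrE ?mulr_ge0 ?sqrtr_ge0 ?(ltW D_gt0) //.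
by rewrite exprMn sqr_sqrtr // -natrX mulrA.
Qed.

(* [Num.sqrt] is [0] on negative numbers, so that [- a] is [D / (2 m)]
   in the underdamped case. *)
Lemma mode_decay_attained :
  let a := (Num.sqrt (D ^+ 2 - 4 * l * m) - D) / (2 * m) in
  exists b, m * (a ^+ 2 - b ^+ 2) + D * a + l = 0 /\ b * (2 * m * a + D) = 0.
Proof.
have m_neq0 : m != 0 by rewrite gt_eqF.
move=> a; rewrite /a; case: (lerP 0 (D ^+ 2 - 4 * l * m)) => [ge0|lt0].
  exists 0; rewrite mul0r; split=> //.
  have := sqr_sqrtr ge0; set S := Num.sqrt _ => SS.
  (* Trading [l] for the root [S] of the discriminant leaves a rational identity. *)
  have -> : l = (D ^+ 2 - S ^+ 2) / (4 * m) by rewrite SS; field.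
  by field.
rewrite ler0_sqrtr ?ltW //.
have := sqr_sqrtr (ltW (_ : 0 < 4 * l * m - D ^+ 2)).
set S := Num.sqrt _ => SS; exists (S / (2 * m)).
have -> : l = (D ^+ 2 + S ^+ 2) / (4 * m).
  by rewrite SS; [field | lra].
by split; field.
Qed.

Variables (a b : R).
Hypothesis re0 : m * (a ^+ 2 - b ^+ 2) + D * a + l = 0.
Hypothesis im0 : b * (2 * m * a + D) = 0.

(** Completing the square handles a real root; otherwise the real part is [- D / (2 m)] and the
    squared modulus is [l / m]. A double root satisfies both. *)
Lemma mode_root_cases :
  b = 0 /\ (2 * m * a + D) ^+ 2 = D ^+ 2 - 4 * l * m \/
  2 * m * a + D = 0 /\ 4 * m ^+ 2 * (a ^+ 2 + b ^+ 2) = 4 * l * m.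
Proof.
move/eqP: im0; rewrite mulf_eq0 => /orP[] /eqP e; [left|right]; split=> //.
  by have := re0; rewrite e; nra.
by have := re0; nra.
Qed.

Lemma mode_Re_lt0 : a < 0.
Proof.
case: mode_root_cases => -[e1 e2]; last first.
  have /pmulr_rlt0 <- : 0 < 2 * m by rewrite mulr_gt0.
  by move: D_gt0; lra.
rewrite ltNge; apply/negP => a_ge0.
have : 0 <= m * a ^+ 2 by rewrite mulr_ge0 ?sqr_ge0 ?ltW.
have : 0 <= D * a by rewrite mulr_ge0 // ltW.
by have := re0; move: l_gt0; rewrite e1; lra.
Qed.

(** For a real root, [2 m a + D] is at most its absolute value, the root of the discriminant;
    otherwise it is [0]. *)
Lemma mode_decay_ge : (D - Num.sqrt (D ^+ 2 - 4 * l * m)) / (2 * m) <= - a.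
Proof.
rewrite ler_pdivrMr ?mulr_gt0 //.
suff : 2 * m * a + D <= Num.sqrt (D ^+ 2 - 4 * l * m) by lra.
case: mode_root_cases => -[e1 e2]; last by rewrite e1 sqrtr_ge0.
by rewrite -e2 sqrtr_sqr ler_norm.
Qed.

(** All poles of one mode share this ratio: an underdamped pair has modulus [sqrt (l / m)], and the
    remaining poles are real and negative. *)
Lemma mode_damping_ratio : damping_ratio (a +i* b)%C =
  if D < 2 * Num.sqrt (l * m) then D / (2 * Num.sqrt (l * m)) else 1.
Proof.
have m_neq0 : m != 0 by rewrite gt_eqF.
rewrite /damping_ratio normc_def /= lt_2sqrt; case: ifPn => [lt|].
  have [[_ e]|[e1 e2]] := mode_root_cases.
    by have := sqr_ge0 (2 * m * a + D); rewrite e; lra.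
  have S_gt0 : 0 < Num.sqrt (l * m) by rewrite sqrtr_gt0 mulr_gt0.
  have := sqr_sqrtr (ltW (mulr_gt0 l_gt0 m_gt0)).
  move: S_gt0; set S := Num.sqrt (l * m) => S_gt0 SS.
  have -> : a ^+ 2 + b ^+ 2 = (S / m) ^+ 2.
    have m4 : 4 * m ^+ 2 != 0 by rewrite mulf_neq0 ?expf_neq0 ?pnatr_eq0.
    by apply: (mulfI m4); rewrite e2 -mulrA -SS; field.
  rewrite sqrtr_sqr ger0_norm ?divr_ge0 ?(ltW S_gt0) ?(ltW m_gt0) //.
  have -> : D = - (2 * m * a) by lra.
  by field; rewrite m_neq0 gt_eqF.
rewrite -leNgt => ge.
have b0 : b = 0.
  have [[//]|[e1 e2]] := mode_root_cases.
  (* Here [4 m^2 a^2 = D^2 >= 4 l m], which the modulus identity turns into a bound on [b]. *)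
  have : m ^+ 2 * b ^+ 2 <= 0 by nra.
  rewrite pmulr_rle0 ?exprn_gt0 // => b2.
  by apply/eqP; rewrite -sqrf_eq0; apply/eqP/le_anti; rewrite b2 sqr_ge0.
rewrite b0 expr0n addr0 sqrtr_sqr ltr0_norm ?mode_Re_lt0 //.
by rewrite divff // oppr_eq0 lt_eqF // mode_Re_lt0.
Qed.

End QuadraticMode.

(** * Extremal modes and the two minima *)

Theorem theorem2 (R : realType) (n : nat) (hn : (2 <= n)%N)
    (m d tau dt db : R)
    (hm : 0 < m) (hd : 0 < d) (htau : 0 < tau) (hdt : 0 < dt) (hdb : 0 <= db)
    (N : power_network R n) (r : 'I_n -> R)
    (hN : proportional N r (g_o m d tau dt) (c_fs tau db dt))
    (lam : n.-tuple R)
    (hlam : sorted_eigenvalues (scaled_laplacian N r) lam) :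
  let lambda1 := lam`_0 in
  let lambda2 := lam`_1 in
  let lambdan := lam`_n.-1 in
  let poles := mode_poles (g_o m d tau dt) (c_fs tau db dt) lam in
  let D := d + db + dt in
  let sigma_a := - (D / (2 * m)) in
  let slow := (D - Num.sqrt (D ^+ 2 - 4 * lambda2 * m)) / (2 * m) in
  let small_db := 0 <= db <= 2 * Num.sqrt (lambda2 * m) - d - dt in
  [/\ lambda1 = 0 /\ 0 < lambda2,
      (forall s, poles s -> complex.Re s < 0),
      is_minimum (@damping_ratio R @` poles)
        (if 0 <= db < 2 * Num.sqrt (lambdan * m) - d - dt
         then D / (2 * Num.sqrt (lambdan * m)) else 1),
      is_minimum (@decay_rate R @` poles)
        (if small_db then D / (2 * m) else slow)
    & (small_db -> D / (2 * m) = `|sigma_a|) /\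
      (~~ small_db -> slow < `|sigma_a|)].
Proof.
move=> lambda1 lambda2 lambdan poles D sigma_a slow small_db.
have r_gt0 i : 0 < r i by case: (hN i).
have [lam1_0 lam2_gt0] := scaled_laplacian_eigenvalues r_gt0 hn hlam.
have D_gt0 : 0 < D by rewrite addr_gt0 // ltr_wpDr.
have mono := sorted_leq_nth le_trans le_refl 0 hlam.1.
have lam_le j k : (j <= k < n)%N -> lam`_j <= lam`_k.
  move=> /andP[jk kn]; apply: mono => //; rewrite inE size_tuple //.
  exact: leq_ltn_trans jk kn.
have lam2_le k : (1 <= k < n)%N -> lambda2 <= lam`_k by exact: lam_le.
have lam_gt0 k : (1 <= k < n)%N -> 0 < lam`_k.
  by move=> kn; exact: lt_le_trans lam2_gt0 (lam2_le k kn).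
have polesE k a b : (1 <= k < n)%N ->
    m * (a ^+ 2 - b ^+ 2) + D * a + lam`_k = 0 /\ b * (2 * m * a + D) = 0 ->
    poles (a +i* b)%C.
  by move=> kn ?; exists k => //; apply/is_pole_mode => //; exact: lam_gt0.
have polesP a b : poles (a +i* b)%C -> exists2 k, (1 <= k < n)%N &
    m * (a ^+ 2 - b ^+ 2) + D * a + lam`_k = 0 /\ b * (2 * m * a + D) = 0.
  case=> k kn pk; exists k => //.
  exact/(is_pole_mode m tau db a b hd hdt (lam_gt0 k kn)).
have nP : (1 <= n.-1 < n)%N by lia.
have smallE : small_db = (D ^+ 2 <= 4 * lambda2 * m).
  rewrite -le_2sqrt // /small_db hdb /= /D.
  by apply/idP/idP; lra.
have sigmaE : `|sigma_a| = D / (2 * m).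
  by rewrite normrN ger0_norm // ltW // divr_gt0 // mulr_gt0.
(* Both branches of the decay rate are [slow], because [Num.sqrt] vanishes on a nonpositive
   discriminant. *)
have decayE : (if small_db then D / (2 * m) else slow) = slow.
  rewrite smallE; case: ifP => // le; rewrite /slow ler0_sqrtr ?subr0 //.
  by rewrite subr_le0.
split=> //.
- case=> a b /polesP[k kn [re im]]; apply: mode_Re_lt0 re im => //.
  exact: lam_gt0.
- have -> : (0 <= db < 2 * Num.sqrt (lambdan * m) - d - dt)
      = (D < 2 * Num.sqrt (lambdan * m)).
    by rewrite hdb /= /D; apply/idP/idP; lra.
  split.
    (* Any pole of the mode of [lambdan] attains the ratio; this supplies one. *)
    have [b [re im]] := mode_decay_attained D lambdan hm.
    eexists; first exact: polesE nP (conj re im).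
    by apply: mode_damping_ratio re im => //; exact: lam_gt0.
  move=> _ [[a b] /polesP[k kn [re im]] <-].
  rewrite (mode_damping_ratio _ _ _ re im) //; last exact: lam_gt0.
  have le_sqrt : Num.sqrt (lam`_k * m) <= Num.sqrt (lambdan * m).
    by rewrite ler_wsqrtr // ler_pM2r // lam_le //; lia.
  have sqrt_gt0 j : (1 <= j < n)%N -> 0 < Num.sqrt (lam`_j * m).
    by move=> jn; rewrite sqrtr_gt0 mulr_gt0 ?lam_gt0.
  (* If mode [k] is underdamped, so is the mode of [lambdan]: the mixed case [gen], [ltk]
     contradicts [le_sqrt]. *)
  case: ifPn => [ltn|gen]; case: ifPn => [ltk|gek] //.
  + by rewrite ler_pM2l // lef_pV2 ?posrE ?mulr_gt0 ?sqrt_gt0 // ler_pM2l.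
  + by rewrite ler_pdivrMr ?mul1r ?mulr_gt0 ?sqrt_gt0 // ltW.
  + by lra.
- rewrite decayE; split.
    have [b root] := mode_decay_attained D lambda2 hm.
    eexists; first exact: polesE (_ : (1 <= 1 < n)%N) root.
    by rewrite /decay_rate /= -mulNr opprB.
  move=> _ [[a b] /polesP[k kn [re im]] <-].
  (* A larger eigenvalue shrinks the discriminant, so the slowest pole of mode [k] decays at least
     as fast as that of [lambda2]. *)
  apply: le_trans (mode_decay_ge hm re im).
  rewrite ler_pM2r ?invr_gt0 ?mulr_gt0 // lerB // ler_wsqrtr // lerB //.
  by rewrite ler_pM2r // ler_pM2l // lam2_le.
- split=> [_|]; first by rewrite sigmaE.
  rewrite smallE -ltNge sigmaE => lt.
  rewrite ltr_pM2r ?invr_gt0 ?mulr_gt0 // gtrBl.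
  by rewrite sqrtr_gt0 subr_gt0.
Qed.
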